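(* Let $\hat G_{x_1y_1}$ and $\hat G_{x_2y_2}$ be radial grid diagrams of size $n$, and let $\gamma_1:\theta_1\mapsto(x_1(\theta_1),y_1(\theta_1))$ and $\gamma_2:\theta_2\mapsto(x_2(\theta_2),y_2(\theta_2))$ be the (smoothed) immersed loops defined by these radial grid diagrams, together with a choice of oriented circular arc in each row. Suppose that $\sum_{i=1}^na_ir_i^2=2\pi k_1$, where $a_i$ is the (signed) angle subtended by the chosen arc in row $i$ of $\hat G_{x_1y_1}$, $r_i$ is the radius of the corresponding circle, and $k_1\in\mathbb{Z}$. Similarly assume that $\sum_{i=1}^nb_ir_i^2=2\pi k_2$, where $b_i$ is the (signed) angle subtended by the chosen arc in row $i$ of $\hat G_{x_2y_2}$, $r_i$ is the radius of the corresponding circle, and $k_2\in\mathbb{Z}$. Then the immersed torus $f:T^2\to B^2$, $$f(\theta_1,\theta_2)=\left(x_1(\theta_1),y_1(\theta_1),x_2(\theta_2),y_2(\theta_2)\right),$$ lifts to an immersed Legendrian torus $\tilde f:T^2\to S^5\subset\mathbb{C}^3$, $$\tilde f(\theta_1,\theta_2)=e^{it(\theta_1,\theta_2)}\left(x_1(\theta_1),y_1(\theta_1),x_2(\theta_2),y_2(\theta_2),\sqrt{1-x_1^2-y_1^2-x_2^2-y_2^2},0\right),$$ where $t(\theta_1,\theta_2)=\int_{f(\gamma)}\tau$ with $\tau=-\sum_{i=1}^2(x_i\,dy_i-y_i\,dx_i)$ and $\gamma$ a path in $T^2$ from a fixed base point to $(\theta_1,\theta_2)$, and the cone of this torus in $\mathbb{C}^3$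 is Lagrangian (as an immersed cone).
   Context: $B^2$ is the open unit ball in $\mathbb{C}^2=\mathbb{R}^4$, with real coordinates $(x_1,y_1,x_2,y_2)$; $\mathbb{C}^3=\mathbb{R}^6$ has real coordinates $(x_1,y_1,x_2,y_2,x_3,y_3)$, and multiplication by $e^{it}$ is complex scalar multiplication. $S^5$ carries the standard contact form, the restriction of $\frac12\sum_{i=1}^3(x_i\,dy_i-y_i\,dx_i)$. The cone on a subset of $S^5$ is obtained by scaling by all $r>0$. A grid diagram of size $n$ is an $n\times n$ grid of cells with $X$ and $Y$ markings, exactly one $X$ and one $Y$ in each row and each column, in distinct cells, such that joining $X$ to $Y$ in each row and $Y$ to $X$ in each column gives a closed oriented loop. In the radial grid diagram obtained from it, the marking in row $i$ and column $j$ is placed in the plane at polar radius $r_i=\sqrt{\frac{i}{3n}}$ and angle $j\frac{2\pi}n$; the two markings in each column are joined by a radial segment as in the original diagram. In each row $i$ there are two arcs of the circle of radius $r_i$ oriented from $X$ to $Y$, and one of the two is chosen in each row. The result is an oriented closed loop. The signed angle of an arc is positive if it runs counterclockwise and negative otherwise. Smoothing: the corners of the resulting piecewise smooth loop are rounded to give a smooth immersed loop, $C^0$-close to it and with the same value of the net-area integral $\int r^2\,d\varphi$ over the loop ($r,\varphi$ polar coordinates). *)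

(* Defs.v *)
From Stdlib Require Import Reals ZArith.
From mathcomp Require Import all_boot all_fingroup.
From Coquelicot Require Import Coquelicot.

Set Implicit Arguments.
Unset Strict Implicit.
Unset Printing Implicit Defensive.

Open Scope R_scope.

(* Real normed spaces.  A point of C is a pair (x, y). *)

Definition Eu1 : NormedModule R_AbsRing := R_NormedModule.
Definition Eu2 : NormedModule R_AbsRing := prod_NormedModule R_AbsRing Eu1 Eu1.
Definition Eu3 : NormedModule R_AbsRing := prod_NormedModule R_AbsRing Eu1 Eu2.
Definition Cn1 : NormedModule R_AbsRing := C_R_NormedModule.
Definition Cn2 : NormedModule R_AbsRing := prod_NormedModule R_AbsRing Cn1 Cn1.
Definition Cn3 : NormedModule R_AbsRing := prod_NormedModule R_AbsRing Cn2 Cn1.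

Definition all_of (U : Type) : U -> Prop := fun _ => True.

(* dF_p(v) = w; for a continuously differentiable F the directional derivative
   is the value of the differential. *)
Definition differential_at (U V : NormedModule R_AbsRing) (F : U -> V)
  (p v : U) (w : V) : Prop :=
  is_derive (fun s : R => F (plus p (scal s v))) 0 w.

(* Class C^k on an open subset D of a finite-dimensional space U: all iterated
   directional derivatives up to order k exist and are continuous on D. *)
Fixpoint class_C (U V : NormedModule R_AbsRing) (D : U -> Prop) (k : nat)
  (F : U -> V) : Prop :=
  (forall p, D p -> continuous F p) /\
  match k with
  | O => True
  | S k' => forall v : U, exists dF : U -> V,
      (forall p, D p -> differential_at F p v (dF p)) /\ class_C D k' dF
  end.

Definition smooth (U V : NormedModule R_AbsRing) (D : U -> Prop) (F : U -> V)
  : Prop := forall k : nat, class_C D k F.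

Definition immersion (U V : NormedModule R_AbsRing) (D : U -> Prop)
  (F : U -> V) : Prop :=
  smooth D F /\
  forall p v, D p -> differential_at F p v zero -> v = zero.

(* The bilinear expression x dy - y dx: with z a point and w a tangent vector
   it is the form r^2 dphi at z; with two tangent vectors it is (dx /\ dy)(z, w). *)
Definition wedge (z w : C) : R := fst z * snd w - snd z * fst w.

Definition contact_form (p w : Cn3) : R :=
  / 2 * (wedge p.1.1 w.1.1 + wedge p.1.2 w.1.2 + wedge p.2 w.2).

Definition symplectic_form (v w : Cn3) : R :=
  wedge v.1.1 w.1.1 + wedge v.1.2 w.1.2 + wedge v.2 w.2.

Definition in_ball2 (p : Cn2) : Prop := Cmod p.1 ^ 2 + Cmod p.2 ^ 2 < 1.

Definition in_sphere5 (p : Cn3) : Prop :=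
  Cmod p.1.1 ^ 2 + Cmod p.1.2 ^ 2 + Cmod p.2 ^ 2 = 1.

(* The integral of x dy - y dx = r^2 dphi along the piecewise smooth plane
   curve z on [a, b]; the finitely many corners do not affect it. *)
Definition angular_integral (z : R -> C) (a b : R) : R :=
  RInt (fun s => fst (z s) * Derive (fun u => snd (z u)) s
               - snd (z s) * Derive (fun u => fst (z u)) s) a b.

(* The integral of tau = - sum_i (x_i dy_i - y_i dx_i) along z on [0, 1]. *)
Definition tau_integral (z : R -> Cn2) : R :=
  - (angular_integral (fun s => (z s).1) 0 1
     + angular_integral (fun s => (z s).2) 0 1).

(* Rows and columns are numbered from 0, so the row (column) number in 1..n is
   i.+1 (j.+1).  Exactly one X (resp. Y) in each row and each column means that
   X (resp. Y) is a permutation, sending a row to the column of its marking. *)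

Record grid (n : nat) := Grid {
  colX : {perm 'I_n};
  colY : {perm 'I_n};
  grid_distinct : forall i, colX i != colY i;
  (* The loop goes from X to Y in row i, then along the column of that Y to its
     X, which lies in row colX^-1 (colY i); it visits every row. *)
  grid_closed_loop : forall i j : 'I_n, j \in porbit (colY * colX^-1)%g i
}.

Definition next_row n (G : grid n) (i : 'I_n) : 'I_n :=
  (colY G * (colX G)^-1)%g i.

Definition radius n (i : 'I_n) : R := sqrt (INR i.+1 / (3 * INR n)).

Definition col_angle n (j : 'I_n) : R := INR j.+1 * (2 * PI / INR n).

(* ccw i tells whether the counterclockwise arc from X to Y is the one chosen
   in row i. *)
Definition arc_angle n (G : grid n) (ccw : 'I_n -> bool) (i : 'I_n) : R :=
  if ccw i
  then INR ((colY G i + (n - colX G i)) %% n)%N * (2 * PI / INR n)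
  else - (INR ((colX G i + (n - colY G i)) %% n)%N * (2 * PI / INR n)).

Definition polar (r phi : R) : C := (r * cos phi, r * sin phi).

(* The radial grid loop from the X of row i0, for s >= 0.  With i the q-th row
   visited, [2q, 2q+1] is the chosen arc of row i and [2q+1, 2q+2] the radial
   segment to the next row, so the period is 2n and corners are integers. *)
Definition radial_loop n (G : grid n) (ccw : 'I_n -> bool) (i0 : 'I_n) (s : R)
  : C :=
  let k := Z.to_nat (Int_part s) in
  let u := frac_part s in
  let i := iter k./2 (next_row G) i0 in
  if odd k
  then polar ((1 - u) * radius i + u * radius (next_row G i))
             (col_angle (colY G i))
  else polar (radius i) (col_angle (colX G i) + u * arc_angle G ccw i).

(* gamma is a smooth immersed loop, 2 PI-periodic, that after an
   orientation-preserving reparametrization h is eps-close to the radial grid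
   loop, differs from it only in the eps-neighbourhoods of the corners, and has
   the same net area. *)
Definition smoothing n (G : grid n) (ccw : 'I_n -> bool) (eps : R)
  (gamma : Eu1 -> Cn1) : Prop :=
  immersion (@all_of Eu1) gamma /\
  (forall th : R, gamma (th + 2 * PI) = gamma th) /\
  exists (i0 : 'I_n) (h : R -> R),
    (forall th : R, continuous h th) /\
    (forall th th' : R, th < th' -> h th < h th') /\
    0 <= h 0 /\ h (2 * PI) = h 0 + 2 * INR n /\
    (forall th, 0 <= th <= 2 * PI ->
       Cmod (gamma th - radial_loop G ccw i0 (h th))%C < eps) /\
    (forall th, 0 <= th <= 2 * PI ->
       (forall k : Z, eps <= Rabs (h th - IZR k)) ->
       gamma th = radial_loop G ccw i0 (h th)) /\
    angular_integral gamma 0 (2 * PI)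
      = angular_integral (radial_loop G ccw i0) 0 (2 * INR n).

(* T^2 = R^2 / (2 PI Z)^2: maps and paths are given on the universal cover. *)

Definition same_torus_point (p q : Eu2) : Prop :=
  exists m k : Z, fst q = fst p + 2 * PI * IZR m /\
                  snd q = snd p + 2 * PI * IZR k.

Definition torus_map (V : Type) (F : Eu2 -> V) : Prop :=
  forall p q, same_torus_point p q -> F p = F q.

Definition immersed_torus (V : NormedModule R_AbsRing) (F : Eu2 -> V) : Prop :=
  torus_map F /\ immersion (@all_of Eu2) F.

Definition class_C1_on (c : Eu1 -> Eu2) (a b : R) : Prop :=
  exists g : Eu1 -> Eu2, class_C (@all_of Eu1) 1 g /\
    forall s, a <= s <= b -> c s = g s.

Inductive piecewise_C1 (c : Eu1 -> Eu2) (a : R) : R -> Prop :=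
| pw_nil : piecewise_C1 c a a
| pw_snoc b d : piecewise_C1 c a b -> b < d -> class_C1_on c b d ->
    piecewise_C1 c a d.

Definition torus_path (c : Eu1 -> Eu2) (p q : Eu2) : Prop :=
  piecewise_C1 c 0 1 /\ same_torus_point p (c 0) /\ same_torus_point q (c 1).

Definition product_torus (gamma1 gamma2 : Eu1 -> Cn1) (th : Eu2) : Cn2 :=
  (gamma1 (fst th), gamma2 (snd th)).

(* The value e^{it} (x1, y1, x2, y2, sqrt (1 - x1^2 - y1^2 - x2^2 - y2^2), 0)
   of the lift, p = (x1 + i y1, x2 + i y2) being the point of the torus f. *)
Definition lift_point (t : R) (p : Cn2) : Cn3 :=
  let e : C := (cos t, sin t) in
  ((e * p.1)%C, (e * p.2)%C,
   (e * RtoC (sqrt (1 - fst p.1 ^ 2 - snd p.1 ^ 2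
                      - fst p.2 ^ 2 - snd p.2 ^ 2)))%C).

Definition immersed_legendrian_torus (F : Eu2 -> Cn3) : Prop :=
  immersed_torus F /\ (forall p, in_sphere5 (F p)) /\
  forall p v w, differential_at F p v w -> contact_form (F p) w = 0.

(* Immersed Lagrangian in C^3, of real dimension 3, over an open domain D. *)
Definition immersed_lagrangian (D : Eu3 -> Prop) (F : Eu3 -> Cn3) : Prop :=
  immersion D F /\
  forall p v1 v2 w1 w2, D p ->
    differential_at F p v1 w1 -> differential_at F p v2 w2 ->
    symplectic_form w1 w2 = 0.

(* The immersed cone is parametrized by (r, p) with r > 0. *)
Definition cone_domain (q : Eu3) : Prop := 0 < fst q.
Definition cone (F : Eu2 -> Cn3) (q : Eu3) : Cn3 :=
  scal (fst q : R_AbsRing) (F (snd q)).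

(* Main.v *)
Require Import Defs.
From Stdlib Require Import Reals ZArith Lra Lia FunctionalExtensionality.
From HB Require Import structures.
From mathcomp Require Import all_boot all_fingroup.
From Coquelicot Require Import Coquelicot.

(** Write z_j for gamma_j and A_j for the integral of x dy - y dx along z_j,
    a primitive of the pulled back form.  The phase of the lift is
    t = - (A_1 + A_2), normalized to vanish at the base point, and three facts
    make the statement true.

    Periods.  On the q-th arc of the radial loop the form x dy - y dx is r^2
    times the change of angle, and on a radial segment it vanishes.  The grid
    loop visits every row once, so its net area is the sum of a_i r_i^2
    ([angular_integral_radial_loop]), and smoothing preserves it.  By assumption
    it is 2 pi k_j; hence going once around a circle factor changes t by a
    multiple of 2 pi, and e^(it) descends to the torus ([lift_same_point]).  For
    the same reason e^(it) depends only on the end point of a path in the torus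
    ([lift_path]).

    Position.  All radii are at most 1 / sqrt 3, so a smoothing that is 1/10
    close to the radial loop has |z_j|^2 < 1/2 ([smoothing_bound]), the product
    torus lies in the open ball, and the square root is smooth there.

    Lagrangian cone.  Put u = (z_1, z_2, h) with h the square root, a unit
    vector whose last entry is real and positive.  A tangent vector of the
    cone over e^(it) u is e^(it) (r' u + r (u' + t' i u)).  Rotation by e^(it)
    preserves the symplectic form w, and since |u| = 1 and <u, u'> = 0 the value
    of w on two such vectors only involves w(u, u') + t', which vanishes because
    dt is minus the pulled back form, and w(u'_1, u'_2), which vanishes because
    each z_j moves along a curve and h is real ([symplectic_form_cone]).  The
    same description gives the immersion property
    ([rotating_cone_velocity_eq0]).  Finally the contact form is half of w
    against the radial vector, so the Legendrian statement follows from the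
    Lagrangian one ([legendrian_of_lagrangian_cone]).

    Smoothness in the sense of iterated directional derivatives needs no total
    derivatives: every map here is built from functions of one real variable,
    linear maps, sums and products, and for these the one-dimensional chain rule
    along lines is enough ([class_C_comp]). *)

Set Implicit Arguments.
Unset Strict Implicit.
Unset Printing Implicit Defensive.

Open Scope R_scope.

(** * Maps of class C^k *)

Lemma eq_is_derive (V : NormedModule R_AbsRing) (f : R -> V) (x : R)
  (l l' : V) :
  is_derive f x l -> l = l' -> is_derive f x l'.
Proof. by move=> Hf <-. Qed.

Lemma is_derive_pair (V W : NormedModule R_AbsRing) (f : R -> V) (g : R -> W)
  (x : R) (lf : V) (lg : W) :
  is_derive f x lf -> is_derive g x lg ->
  @is_derive R_AbsRing (prod_NormedModule R_AbsRing V W)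
    (fun s => (f s, g s)) x (lf, lg).
Proof.
move=> Hf Hg.
have Hpair : @filterdiff R_AbsRing (prod_NormedModule R_AbsRing V W)
    (prod_NormedModule R_AbsRing V W) (fun t => (t.1, t.2))
    (locally (f x, g x)) (fun t => (t.1, t.2)).
  apply: (filterdiff_ext_lin _ (fun t => t)); last by case.
  apply: (filterdiff_ext (fun t => t)); first by case.
  exact: filterdiff_id.
exact: (filterdiff_comp'_2 (W := prod_NormedModule R_AbsRing V W)
  _ _ (fun a b => (a, b)) x _ _ (fun a b => (a, b)) Hf Hg Hpair).
Qed.

Lemma is_derive_linear (V W : NormedModule R_AbsRing) (L : V -> W)
  (f : R -> V) (x : R) (l : V) :
  is_linear L -> is_derive f x l -> is_derive (fun s => L (f s)) x (L l).
Proof.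
move=> HL Hf.
have H := filterdiff_comp' _ _ _ _ _ Hf
  (filterdiff_linear (F := locally (f x)) _ HL).
apply: filterdiff_ext_lin H _ => y; exact: linear_scal.
Qed.

Lemma is_derive_fst (V W : NormedModule R_AbsRing)
  (f : R -> prod_NormedModule R_AbsRing V W) (x : R) l :
  is_derive f x l -> is_derive (fun s => fst (f s)) x (fst l).
Proof. exact: (is_derive_linear is_linear_fst). Qed.

Lemma is_derive_snd (V W : NormedModule R_AbsRing)
  (f : R -> prod_NormedModule R_AbsRing V W) (x : R) l :
  is_derive f x l -> is_derive (fun s => snd (f s)) x (snd l).
Proof. exact: (is_derive_linear is_linear_snd). Qed.

Lemma continuous_pair (T U V : UniformSpace) (f : T -> U) (g : T -> V) (x : T) :
  continuous f x -> continuous g x ->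
  @continuous T (prod_UniformSpace U V) (fun t => (f t, g t)) x.
Proof.
move=> Hf Hg.
have Hid : @continuous (prod_UniformSpace U V) (prod_UniformSpace U V)
    (fun t => (t.1, t.2)) (f x, g x).
  apply: (continuous_ext (fun t : prod_UniformSpace U V => t)); first by case.
  exact: continuous_id.
exact: (continuous_comp_2 f g (fun a b => (a, b) : prod_UniformSpace U V) x).
Qed.

Lemma is_linear_continuous (V W : NormedModule R_AbsRing) (L : V -> W) p :
  is_linear L -> continuous L p.
Proof.
move=> HL; apply: filterdiff_continuous; exists L.
exact: filterdiff_linear.
Qed.

Lemma class_C_continuous (U V : NormedModule R_AbsRing)
  (D : U -> Prop) k (F : U -> V) p :
  class_C D k F -> D p -> continuous F p.
Proof. by case: k => [|k] [HF _]; exact: HF. Qed.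

Lemma class_C_pred (U V : NormedModule R_AbsRing)
  (D : U -> Prop) k (F : U -> V) :
  class_C D k.+1 F -> class_C D k F.
Proof.
elim: k F => [|k IH] F [HF HdF]; split=> // v.
have [dF [HdFv CdF]] := HdF v.
by exists dF; split=> //; exact: IH.
Qed.

Lemma class_C_mono (U V : NormedModule R_AbsRing)
  (D E : U -> Prop) k (F : U -> V) :
  (forall p, E p -> D p) -> class_C D k F -> class_C E k F.
Proof.
move=> ED; elim: k F => [|k IH] F [HF HdF]; split=> //; try by move=> p /ED /HF.
move=> v; have [dF [HdFv CdF]] := HdF v.
by exists dF; split=> [p /ED /HdFv|] //; exact: IH.
Qed.

Lemma class_C_const (U V : NormedModule R_AbsRing)
  (D : U -> Prop) k (c : V) : class_C D k (fun _ => c).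
Proof.
elim: k c => [|k IH] c; split=> //; try by move=> p _; exact: continuous_const.
move=> v; exists (fun _ => zero); split=> // p _; exact: is_derive_const.
Qed.

Lemma class_C_postlinear (U V W : NormedModule R_AbsRing)
  (D : U -> Prop) k (F : U -> V) (L : V -> W) :
  is_linear L -> class_C D k F -> class_C D k (fun p => L (F p)).
Proof.
move=> HL; elim: k F => [|k IH] F [HF HdF]; split=> //;
  try by move=> p /HF HFp; apply: (continuous_comp F L) => //;
         exact: is_linear_continuous.
move=> v; have [dF [HdFv CdF]] := HdF v.
exists (fun p => L (dF p)); split; last exact: IH.
move=> p /HdFv; exact: is_derive_linear.
Qed.

Lemma class_C_prelinear (U V W : NormedModule R_AbsRing)
  (D : V -> Prop) k (F : V -> W) (L : U -> V) :
  is_linear L -> class_C D k F ->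
  class_C (fun p => D (L p)) k (fun p => F (L p)).
Proof.
move=> HL; elim: k F => [|k IH] F [HF HdF]; split=> //;
  try by move=> p /HF HFp; apply: (continuous_comp L F) => //;
         exact: is_linear_continuous.
move=> v; have [dF [HdFv CdF]] := HdF (L v).
exists (fun p => dF (L p)); split; last exact: IH.
move=> p /HdFv; apply: is_derive_ext => s.
by rewrite (linear_plus _ HL) (linear_scal _ HL).
Qed.

Lemma class_C_linear (U V : NormedModule R_AbsRing)
  (D : U -> Prop) k (L : U -> V) :
  is_linear L -> class_C D k L.
Proof.
move=> HL; case: k => [|k]; split=> //;
  try by move=> p _; exact: is_linear_continuous.
move=> v; exists (fun _ => L v); split; last exact: class_C_const.
move=> p _; apply: (is_derive_ext (fun s => plus (L p) (scal s (L v)))).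
  by move=> s; rewrite (linear_plus _ HL) (linear_scal _ HL).
rewrite -[X in is_derive _ _ X]plus_zero_l -[X in plus _ X]scal_one.
apply: is_derive_plus; first exact: is_derive_const.
apply: is_derive_scal_l; exact: is_derive_id.
Qed.

Lemma class_C_pair (U V W : NormedModule R_AbsRing)
  (D : U -> Prop) k (F : U -> V) (G : U -> W) :
  class_C D k F -> class_C D k G ->
  @class_C U (prod_NormedModule R_AbsRing V W) D k (fun p => (F p, G p)).
Proof.
elim: k F G => [|k IH] F G [HF HdF] [HG HdG]; split=> //;
  try by move=> p Dp; apply: continuous_pair; [exact: HF|exact: HG].
move=> v; have [dF [HdFv CdF]] := HdF v; have [dG [HdGv CdG]] := HdG v.
exists (fun p => (dF p, dG p)); split; last exact: IH.
move=> p Dp; apply: is_derive_pair; [exact: HdFv|exact: HdGv].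
Qed.

Lemma class_C_plus (U V : NormedModule R_AbsRing)
  (D : U -> Prop) k (F G : U -> V) :
  class_C D k F -> class_C D k G -> class_C D k (fun p => plus (F p) (G p)).
Proof.
elim: k F G => [|k IH] F G [HF HdF] [HG HdG]; split=> //;
  try by move=> p Dp; apply: continuous_plus; [exact: HF|exact: HG].
move=> v; have [dF [HdFv CdF]] := HdF v; have [dG [HdGv CdG]] := HdG v.
exists (fun p => plus (dF p) (dG p)); split; last exact: IH.
move=> p Dp; apply: is_derive_plus; [exact: HdFv|exact: HdGv].
Qed.

Lemma class_C_scal (U V : NormedModule R_AbsRing) (D : U -> Prop) k
  (F : U -> Eu1) (G : U -> V) :
  class_C D k F -> class_C D k G ->
  class_C D k (fun p => scal (F p : R_AbsRing) (G p)).
Proof.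
have cont j (F' : U -> Eu1) (G' : U -> V) p :
    class_C D j F' -> class_C D j G' -> D p ->
    continuous (fun p => scal (F' p : R_AbsRing) (G' p)) p.
  move=> CF CG Dp; apply: (continuous_scal F' G').
    exact: class_C_continuous CF Dp.
  exact: class_C_continuous CG Dp.
elim: k F G => [|k IH] F G CF CG; split=> //;
  try by move=> p; exact: cont CF CG.
move=> v; have [dF [HdFv CdF]] := CF.2 v; have [dG [HdGv CdG]] := CG.2 v.
exists (fun p => plus (scal (dF p : R_AbsRing) (G p))
                      (scal (F p : R_AbsRing) (dG p))); split.
  move=> p Dp.
  have := filterdiff_scal_fct _ _ _ _ _ Rmult_comm (HdFv p Dp) (HdGv p Dp).
  rewrite scal_zero_l plus_zero_r => H.
  apply: filterdiff_ext_lin H _ => y.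
  rewrite scal_distr_l scal_assoc [X in scal X (dG p)]Rmult_comm !scal_assoc.
  by rewrite [X in plus _ (scal X _)]Rmult_comm.
by apply: class_C_plus; apply: IH => //; exact: class_C_pred.
Qed.

Lemma class_C_mult (U : NormedModule R_AbsRing) (D : U -> Prop) k
  (F G : U -> Eu1) :
  class_C D k F -> class_C D k G -> class_C D k (fun p => F p * G p : Eu1).
Proof. exact: class_C_scal. Qed.

Lemma is_derive_of_differential (V : NormedModule R_AbsRing)
  (g : Eu1 -> V) (x : R) (w : V) :
  differential_at g x 1 w -> is_derive g x w.
Proof.
move=> Hg.
have Hshift : is_derive (fun y : R => y - x) x 1 by auto_derive.
have H0 : is_derive (fun s : R => g (x + s * 1)) (x - x) w.
  rewrite Rminus_diag; exact: Hg.
have := is_derive_comp (fun s => g (x + s * 1)) (fun y => y - x) x w 1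
  H0 Hshift.
rewrite scal_one; apply: is_derive_ext => y; congr (g _) => /=; ring.
Qed.

Lemma differential_of_is_derive (V : NormedModule R_AbsRing)
  (g : Eu1 -> V) (x v : R) (w : V) :
  is_derive g x w -> differential_at g x v (scal v w).
Proof.
move=> Hg.
have Hline : is_derive (fun s : R => x + s * v) 0 v by auto_derive=> //; ring.
have Hg0 : is_derive g (x + 0 * v) w by rewrite Rmult_0_l Rplus_0_r.
exact: (is_derive_comp g (fun s => x + s * v) 0 w v Hg0 Hline).
Qed.
(** The outer function has one real variable, so the restriction of the
    composite to a line is a composite of functions of one variable; for an
    outer map on a larger space, directional derivatives alone would not give
    a chain rule. *)
Lemma class_C_comp (U : NormedModule R_AbsRing)
  (D : U -> Prop) (E : Eu1 -> Prop) k
  (g : Eu1 -> Eu1) (F : U -> Eu1) :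
  (forall p, D p -> E (F p)) ->
  class_C E k g -> class_C D k F -> class_C D k (fun p => g (F p)).
Proof.
move=> DE; elim: k g => [|k IH] g Cg CF; split=> //;
  try by move=> p Dp; apply: (continuous_comp F g);
         [exact: class_C_continuous CF Dp
         |exact: class_C_continuous Cg (DE p Dp)].
move=> v; have [dF [HdFv CdF]] := CF.2 v; have [dg [Hdg Cdg]] := Cg.2 1.
exists (fun p => dF p * dg (F p) : Eu1); split; last first.
  by apply: class_C_mult => //; apply: IH => //; exact: class_C_pred.
move=> p Dp.
have Hg : is_derive g (F p) (dg (F p)).
  exact: is_derive_of_differential (Hdg _ (DE p Dp)).
have H := HdFv p Dp.
have Hg0 : is_derive g (F (plus p (scal 0 v))) (dg (F p)).
  by rewrite scal_zero_l plus_zero_r.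
exact: (is_derive_comp g _ _ _ _ Hg0 H).
Qed.


(** A derivative expressed through the function itself gains one order at each
    application; this is how [cos], [sin], the inverse and the square root are
    seen to be smooth. *)
Lemma class_C_of_is_derive (D : Eu1 -> Prop) k (g g' : Eu1 -> Eu1) :
  (forall x, D x -> is_derive g x (g' x)) -> class_C D k g' ->
  class_C D k.+1 g.
Proof.
move=> Hg Cg'; split.
  by move=> x /Hg Hx; apply: ex_derive_continuous; exists (g' x).
move=> v; exists (fun x => v * g' x : Eu1); split.
  by move=> x /Hg; exact: differential_of_is_derive.
apply: class_C_mult => //; exact: class_C_const.
Qed.

(** [class_C] provides, for each order, some function that is the derivative;
    uniqueness of derivatives identifies all of them with [Derive g]. *)
Lemma smooth_Derive (g : Eu1 -> Eu1) :
  smooth (@all_of Eu1) g ->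
  (forall x, is_derive g x (Derive g x)) /\ smooth (@all_of Eu1) (Derive g).
Proof.
move=> Sg; split=> [x|k].
  have [dg [Hdg _]] := (Sg 1%N).2 1.
  apply: Derive_correct; exists (dg x).
  exact: is_derive_of_differential (Hdg x I).
have [dg [Hdg Cdg]] := (Sg k.+1).2 1.
suff -> : Derive g = dg by [].
apply: functional_extensionality => x; apply: is_derive_unique.
exact: is_derive_of_differential (Hdg x I).
Qed.

Lemma class_C_opp (U : NormedModule R_AbsRing) (D : U -> Prop) k
  (F : U -> Eu1) :
  class_C D k F -> class_C D k (fun p => - F p : Eu1).
Proof.
move=> CF; rewrite (_ : (fun p => _) = fun p => -1 * F p : Eu1).
  by apply: class_C_mult => //; exact: class_C_const.
by apply: functional_extensionality => p; rewrite /=; ring.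
Qed.

Lemma class_C_minus (U : NormedModule R_AbsRing) (D : U -> Prop) k
  (F G : U -> Eu1) :
  class_C D k F -> class_C D k G -> class_C D k (fun p => F p - G p : Eu1).
Proof.
by move=> CF CG; apply: (@class_C_plus U Eu1) => //; exact: class_C_opp.
Qed.

Lemma class_C_sqr (U : NormedModule R_AbsRing) (D : U -> Prop) k
  (F : U -> Eu1) :
  class_C D k F -> class_C D k (fun p => F p ^ 2 : Eu1).
Proof.
move=> CF; apply: class_C_mult => //; apply: class_C_mult => //.
exact: class_C_const.
Qed.

Lemma class_C_Cmult (U : NormedModule R_AbsRing) (D : U -> Prop) k
  (F G : U -> Cn1) :
  class_C D k F -> class_C D k G ->
  class_C D k (fun p => (F p * G p)%C : Cn1).
Proof.
move=> CF CG.
have Cx := class_C_postlinear is_linear_fst CF.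
have Cy := class_C_postlinear is_linear_snd CF.
have Cu := class_C_postlinear is_linear_fst CG.
have Cv := class_C_postlinear is_linear_snd CG.
apply: (@class_C_pair U Eu1 Eu1).
  by apply: class_C_minus; exact: class_C_mult.
by apply: (@class_C_plus U Eu1); exact: class_C_mult.
Qed.

Lemma class_C_cos_sin (D : Eu1 -> Prop) k :
  class_C D k (cos : Eu1 -> Eu1) /\ class_C D k (sin : Eu1 -> Eu1).
Proof.
elim: k => [|k [IHc IHs]].
  by split; split=> // x _; [exact: continuous_cos|exact: continuous_sin].
split.
  apply: (@class_C_of_is_derive _ _ _ (fun x => - sin x)).
    by move=> x _; auto_derive=> //; ring.
  exact: class_C_opp.
apply: (@class_C_of_is_derive _ _ _ cos) => // x _.
by auto_derive=> //; ring.
Qed.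

Definition positive (x : Eu1) : Prop := 0 < x.

Lemma class_C_Rinv k : class_C positive k (Rinv : Eu1 -> Eu1).
Proof.
elim: k => [|k IH].
  split=> // x /= Dx; apply: continuous_Rinv; rewrite /positive in Dx; lra.
apply: (@class_C_of_is_derive _ _ _ (fun x => - (/ x * / x))).
  move=> x Dx; rewrite /positive in Dx; auto_derive; first by lra.
  by field; lra.
by apply: class_C_opp; exact: class_C_mult.
Qed.

Lemma class_C_sqrt k : class_C positive k (sqrt : Eu1 -> Eu1).
Proof.
elim: k => [|k IH].
  by split=> // x _; exact: continuous_sqrt.
apply: (@class_C_of_is_derive _ _ _ (fun x => / 2 * / sqrt x)).
  move=> x Dx; have := sqrt_lt_R0 x Dx => Hs; auto_derive=> //.
  by field; lra.
apply: class_C_mult; first exact: class_C_const.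
apply: (class_C_comp (E := positive)) => //; last exact: class_C_Rinv.
by move=> x; exact: sqrt_lt_R0.
Qed.

(** * The angular form along a curve *)

Lemma Cn1_eq (z w : Cn1) : fst z = fst w -> snd z = snd w -> z = w.
Proof. by case: z => a b; case: w => c d /= -> ->. Qed.

(** With this notation [angular_integral z a b] is by definition the integral
    of [wedge (z s) (velocity z s)]. *)
Definition velocity (z : R -> C) (s : R) : C :=
  (Derive (fun u => fst (z u)) s, Derive (fun u => snd (z u)) s).

Lemma velocity_unique (z : R -> C) (s : R) (w : C) :
  @is_derive R_AbsRing Cn1 z s w -> velocity z s = w.
Proof.
move=> H; rewrite (surjective_pairing w) /velocity; congr pair.
  exact: is_derive_unique (is_derive_fst H).
exact: is_derive_unique (is_derive_snd H).
Qed.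

Lemma velocity_ext_interval (z1 z2 : R -> C) (a b s : R) :
  a < s < b -> (forall r, a < r < b -> z1 r = z2 r) ->
  velocity z1 s = velocity z2 s.
Proof.
move=> Hs H12.
have Hloc : locally s (fun r => z1 r = z2 r).
  have Hp : 0 < Rmin (s - a) (b - s) by apply: Rmin_pos; lra.
  exists (mkposreal _ Hp) => r /= Hr; apply: H12.
  have := Rmin_l (s - a) (b - s); have := Rmin_r (s - a) (b - s).
  by move: Hr; rewrite /ball /= /AbsRing_ball /abs /minus /plus /opp /= =>
    /Rabs_lt_between; lra.
by congr pair; apply: Derive_ext_loc; apply: filter_imp Hloc => u ->.
Qed.

Lemma wedge_scal (a : R) (z w : C) :
  wedge z (scal (a : R_AbsRing) (w : Cn1)) = a * wedge z w.
Proof. by rewrite /wedge /= /scal /= /mult /=; ring. Qed.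

Section SmoothPlaneCurve.
Variable gamma : Eu1 -> Cn1.
Hypothesis smooth_gamma : smooth (@all_of Eu1) gamma.

Let smooth_x : smooth (@all_of Eu1) (fun s => fst (gamma s) : Eu1).
Proof.
move=> k; exact: (class_C_postlinear is_linear_fst (smooth_gamma k)).
Qed.

Let smooth_y : smooth (@all_of Eu1) (fun s => snd (gamma s) : Eu1).
Proof.
move=> k; exact: (class_C_postlinear is_linear_snd (smooth_gamma k)).
Qed.

Lemma is_derive_velocity s :
  @is_derive R_AbsRing Cn1 gamma s (velocity gamma s).
Proof.
apply: (is_derive_ext (fun u => (fst (gamma u), snd (gamma u)) : Cn1)).
  by move=> u; rewrite -surjective_pairing.
apply: (@is_derive_pair Eu1 Eu1).
  exact: (smooth_Derive smooth_x).1.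
exact: (smooth_Derive smooth_y).1.
Qed.

Lemma smooth_angular_form :
  smooth (@all_of Eu1) (fun s => wedge (gamma s) (velocity gamma s) : Eu1).
Proof.
move=> k.
rewrite /wedge /velocity /=.
have Hx := smooth_x k; have Hy := smooth_y k.
have Hx' := (smooth_Derive smooth_x).2 k.
have Hy' := (smooth_Derive smooth_y).2 k.
apply: (@class_C_plus Eu1 Eu1); first exact: class_C_mult.
apply: class_C_opp; exact: class_C_mult.
Qed.

Lemma continuous_angular_form s :
  continuous (fun s => wedge (gamma s) (velocity gamma s)) s.
Proof. exact: (class_C_continuous (smooth_angular_form 0%N) I). Qed.

Lemma is_RInt_angular_form a b :
  is_RInt (fun s => wedge (gamma s) (velocity gamma s)) a b
    (angular_integral gamma a b).
Proof.
apply: (RInt_correct (V := R_CompleteNormedModule)).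
apply: ex_RInt_continuous => s _; exact: continuous_angular_form.
Qed.

Lemma is_derive_angular_integral a s :
  is_derive (angular_integral gamma a) s (wedge (gamma s) (velocity gamma s)).
Proof.
apply: (is_derive_RInt (V := R_NormedModule)
  (fun s => wedge (gamma s) (velocity gamma s)) _ a).
  by apply: filter_forall => b; exact: is_RInt_angular_form.
exact: continuous_angular_form.
Qed.

Lemma smooth_angular_integral a :
  smooth (@all_of Eu1) (angular_integral gamma a : Eu1 -> Eu1).
Proof.
move=> k; apply: class_C_pred.
apply: (class_C_of_is_derive
  (g' := fun s => wedge (gamma s) (velocity gamma s))).
  by move=> s _; exact: is_derive_angular_integral.
exact: smooth_angular_form.
Qed.

Lemma is_derive_angular_integral_line a s v :
  is_derive (fun u => angular_integral gamma a (s + u * v)) 0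
    (wedge (gamma s) (scal (v : R_AbsRing) (velocity gamma s : Cn1))).
Proof.
rewrite wedge_scal.
exact: differential_of_is_derive (is_derive_angular_integral a s).
Qed.

(** The difference of the two sides has zero derivative in [s], because the form
    is periodic too, so it equals its value at [0]. *)
Lemma angular_integral_periodic a T :
  (forall s, gamma (s + T) = gamma s) ->
  forall s, angular_integral gamma a (s + T)
    = angular_integral gamma a s + angular_integral gamma 0 T.
Proof.
move=> per s.
pose D s := angular_integral gamma a (s + T) - angular_integral gamma a s.
have Hv u : velocity gamma (u + T) = velocity gamma u.
  apply: velocity_unique.
  have Hsh : is_derive (fun y : R => y - T) (u + T) 1 by auto_derive.
  have H0 : @is_derive R_AbsRing Cn1 gamma (u + T - T) (velocity gamma u).
    by rewrite (_ : u + T - T = u); [exact: is_derive_velocity|ring].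
  have := is_derive_comp gamma (fun y => y - T) (u + T) _ _ H0 Hsh.
  rewrite scal_one; apply: is_derive_ext => y.
  by rewrite -[y in RHS](_ : y - T + T = y) ?per //; ring.
have HD u : is_derive D u 0.
  have Hsh : is_derive (fun y : R => y + T) u 1 by auto_derive.
  have H1 := is_derive_comp (angular_integral gamma a) (fun y => y + T) u _ _
    (is_derive_angular_integral a (u + T)) Hsh.
  have := is_derive_minus _ _ _ _ _ H1 (is_derive_angular_integral a u).
  by rewrite scal_one per Hv minus_eq_zero.
have HDc : D s = D 0.
  have dD u : Rmin 0 s < u < Rmax 0 s -> is_derive D u ((fun _ => 0) u).
    by move=> _; exact: HD.
  have cD u : Rmin 0 s <= u <= Rmax 0 s -> continuity_pt D u.
    move=> _; apply/continuity_pt_filterlim.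
    by apply: (ex_derive_continuous D); exists 0; exact: HD.
  have [e [_ De]] := MVT_gen D 0 s _ dD cD; lra.
have Hch : plus (angular_integral gamma a 0) (angular_integral gamma 0 T)
           = angular_integral gamma a T.
  by apply: RInt_Chasles; eexists; exact: is_RInt_angular_form.
move: HDc; rewrite /D Rplus_0_l -Hch /plus /=; lra.
Qed.

End SmoothPlaneCurve.

Lemma periodic_IZR (V : Type) (F : R -> V) T :
  (forall s, F (s + T) = F s) -> forall m s, F (s + T * IZR m) = F s.
Proof.
move=> per m.
have perN (k : nat) s : F (s + T * INR k) = F s.
  elim: k s => [|k IH] s; first by rewrite /= Rmult_0_r Rplus_0_r.
  rewrite S_INR -[RHS]IH -[RHS]per; congr F; ring.
case: m => [|p|p] s.
- by rewrite Rmult_0_r Rplus_0_r.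
- by rewrite -positive_nat_Z -INR_IZR_INZ perN.
rewrite -[LHS](perN (Pos.to_nat p)) INR_IZR_INZ positive_nat_Z; congr F.
by rewrite -Pos2Z.opp_pos opp_IZR; ring.
Qed.

(** * Paths *)

(** [L] is a coordinate of the torus.  On each C^1 piece the integrand is the
    derivative of the primitive composed with the path; at the finitely many
    break points the derivative in the integrand may be meaningless, but the
    pieces are compared on open intervals only. *)
Lemma angular_integral_path (gamma : Eu1 -> Cn1) (L : Eu2 -> Eu1) x0 c a b :
  smooth (@all_of Eu1) gamma -> is_linear L -> piecewise_C1 c a b ->
  is_RInt (fun s => wedge (gamma (L (c s)))
                      (velocity (fun u => gamma (L (c u))) s)) a b
    (angular_integral gamma x0 (L (c b)) - angular_integral gamma x0 (L (c a))).
Proof.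
move=> Sg HL; elim=> [|d e Hab IH Hde [g [Cg cg]]].
  by rewrite Rminus_diag; exact: is_RInt_point.
pose A := angular_integral gamma x0.
pose u s := L (g s).
have Cu : class_C (@all_of Eu1) 1 u by exact: class_C_postlinear.
have [du [Hdu Cdu]] := Cu.2 1.
have Hu s : is_derive u s (du s) by exact: is_derive_of_differential (Hdu s I).
pose w s := wedge (gamma (u s)) (velocity gamma (u s)).
have Hseg : is_RInt (fun s => du s * w s) d e (A (u e) - A (u d)).
  apply: (is_RInt_derive (V := R_CompleteNormedModule)
    (fun s => A (u s))) => s _.
    exact: (is_derive_comp A u _ _ _
      (is_derive_angular_integral Sg x0 (u s)) (Hu s)).
  apply: (continuous_mult du w); first exact: Cdu.1.
  apply: (continuous_comp u (fun s => wedge (gamma s) (velocity gamma s))).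
    exact: Cu.1.
  exact: continuous_angular_form.
have Hd : c d = g d by apply: cg; lra.
have He : c e = g e by apply: cg; lra.
rewrite (_ : _ - _ = plus (A (L (c d)) - A (L (c a))) (A (u e) - A (u d)));
  last by rewrite /plus /= /A /u -Hd -He; ring.
apply: is_RInt_Chasles IH _.
apply: is_RInt_ext Hseg => s.
rewrite Rmin_left ?Rmax_right; try lra; move=> Hs.
rewrite -(velocity_ext_interval (z1 := fun r => gamma (u r)) Hs); last first.
  by move=> r Hr; rewrite /u cg //; lra.
have -> : velocity (fun r => gamma (u r)) s
   = scal (du s : R_AbsRing) (velocity gamma (u s) : Cn1).
  apply: velocity_unique.
  exact: (is_derive_comp gamma u _ _ _ (is_derive_velocity Sg (u s)) (Hu s)).
by rewrite wedge_scal cg; [|lra].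
Qed.

(** * Net area of the radial loop *)

(* Gives reindexing lemmas for sums of reals written with [\big[Rplus/0]]. *)
HB.instance Definition _ := Monoid.isComLaw.Build R 0 Rplus
  (fun x y z => esym (Rplus_assoc x y z)) Rplus_comm Rplus_0_l.

(** The condition that the grid is a single loop says that [next_row] is one
    cycle, so that its first [n] iterates run over all rows. *)
Lemma big_next_row n (G : grid n) (i0 : 'I_n) (F : 'I_n -> R) :
  \big[Rplus/0]_(0 <= j < n) F (iter j (next_row G) i0)
  = \big[Rplus/0]_(i < n) F i.
Proof.
set s := (colY G * (colX G)^-1)%g.
have Hcard : #|porbit s i0| = n.
  rewrite (_ : porbit s i0 = [set: 'I_n]%SET) ?cardsT ?card_ord //.
  by apply/setP => i; rewrite inE; exact: grid_closed_loop.
have Huniq := uniq_traject_porbit s i0.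
have Hmem := porbit_traject s i0.
rewrite Hcard in Huniq Hmem.
have Hperm : perm_eq (traject s i0 n) (enum 'I_n).
  apply: uniq_perm => //; first exact: enum_uniq.
  move=> i; rewrite mem_enum -Hmem /=; apply: grid_closed_loop.
rewrite -[RHS]big_enum -(perm_big _ Hperm) /=.
have Htraj m : \big[Rplus/0]_(i <- traject s i0 m) F i
      = \big[Rplus/0]_(0 <= j < m) F (iter j (next_row G) i0).
  elim: m => [|m IHm]; first by rewrite big_geq // big_nil.
  by rewrite trajectSr big_rcons big_nat_recr //= IHm.
exact: esym (Htraj n).
Qed.

Lemma wedge_polar r r' phi phi' :
  wedge (polar r phi)
    (r' * cos phi - r * phi' * sin phi, r' * sin phi + r * phi' * cos phi)
  = r ^ 2 * phi'.
Proof.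
rewrite /wedge /polar /=.
have := sin2_cos2 phi; rewrite /Rsqr => H.
transitivity (r * r * phi' * (sin phi * sin phi + cos phi * cos phi)).
  by ring.
by rewrite H; ring.
Qed.

Lemma is_derive_polar (r phi : R -> R) s r' phi' :
  is_derive r s r' -> is_derive phi s phi' ->
  @is_derive R_AbsRing Cn1 (fun u => polar (r u) (phi u)) s
   (r' * cos (phi s) - r s * phi' * sin (phi s),
    r' * sin (phi s) + r s * phi' * cos (phi s)).
Proof.
move=> Hr Hphi; apply: (@is_derive_pair Eu1 Eu1).
  have Hc : is_derive (fun u => cos (phi u)) s (phi' * - sin (phi s)).
    by apply: (is_derive_comp cos phi) => //; auto_derive=> //; ring.
  have := is_derive_mult r _ _ _ _ Hr Hc Rmult_comm.
  by congr (is_derive _ _ _); rewrite /plus /mult /=; ring.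
have Hc : is_derive (fun u => sin (phi u)) s (phi' * cos (phi s)).
  by apply: (is_derive_comp sin phi) => //; auto_derive=> //; ring.
have := is_derive_mult r _ _ _ _ Hr Hc Rmult_comm.
by congr (is_derive _ _ _); rewrite /plus /mult /=; ring.
Qed.

Lemma Int_part_between (k : nat) s : INR k <= s < INR k.+1 ->
  Z.to_nat (Int_part s) = k /\ frac_part s = s - INR k.
Proof.
rewrite S_INR INR_IZR_INZ => Hs.
have [Hi Hf] := @Int_part_frac_part_spec s (Z.of_nat k) (s - IZR (Z.of_nat k))
  ltac:(lra) ltac:(ring).
by rewrite -Hi -Hf Nat2Z.id.
Qed.

(** The corners: [z] need only agree with the smooth [w] inside the interval. *)
Lemma is_RInt_piece (z w : R -> C) (dw : R -> Cn1) a b c :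
  a <= b ->
  (forall s, a < s < b -> z s = w s) ->
  (forall s, @is_derive R_AbsRing Cn1 w s (dw s)) ->
  (forall s, wedge (w s) (dw s) = c) ->
  is_RInt (fun s => wedge (z s) (velocity z s)) a b ((b - a) * c).
Proof.
move=> ab zw Hw Hc.
apply: is_RInt_ext (is_RInt_const a b c) => s.
rewrite Rmin_left ?Rmax_right; try lra; move=> Hs.
rewrite zw // (velocity_ext_interval Hs zw).
by rewrite (velocity_unique (Hw s)) Hc.
Qed.

Lemma Cmod_polar r phi : 0 <= r -> Cmod (polar r phi) = r.
Proof.
move=> r0; rewrite /Cmod /polar /= -[RHS](sqrt_pow2 r) //; congr sqrt.
have := sin2_cos2 phi; rewrite /Rsqr => H.
transitivity (r * r * (sin phi * sin phi + cos phi * cos phi)); first ring.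
by rewrite H; ring.
Qed.

Lemma radius_bounds n (i : 'I_n) : 0 <= radius i <= sqrt (1 / 3).
Proof.
split; first exact: sqrt_pos.
have Hi : INR i.+1 <= INR n by apply: le_INR; apply/ssrnat.leP; exact: ltn_ord.
have Hi0 : 0 < INR i.+1 by apply: lt_0_INR; lia.
apply: sqrt_le_1_alt.
apply: (Rmult_le_reg_r (3 * INR n)); first lra.
by field_simplify; lra.
Qed.

Section RadialLoop.
Variables (n : nat) (G : grid n) (ccw : 'I_n -> bool) (i0 : 'I_n).
Let row q := iter q (next_row G) i0.

Lemma radial_loop_arc q s : INR q.*2 <= s < INR q.*2.+1 ->
  radial_loop G ccw i0 s
  = polar (radius (row q)) (col_angle (colX G (row q))
                            + (s - INR q.*2) * arc_angle G ccw (row q)).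
Proof.
move=> /Int_part_between [Hi Hf].
by rewrite /radial_loop Hi Hf odd_double doubleK.
Qed.

Lemma radial_loop_segment q s : INR q.*2.+1 <= s < INR q.*2.+2 ->
  radial_loop G ccw i0 s
  = polar ((1 - (s - INR q.*2.+1)) * radius (row q)
           + (s - INR q.*2.+1) * radius (row q.+1))
          (col_angle (colY G (row q))).
Proof.
move=> /Int_part_between [Hi Hf].
by rewrite /radial_loop Hi Hf oddS odd_double /= uphalf_double.
Qed.

(** One row contributes an arc, where the angle moves at constant speed
    [arc_angle] and the radius is fixed, and a segment, where the angle is
    fixed and the form vanishes. *)
Lemma is_RInt_radial_loop (q : nat) :
  is_RInt (fun s => wedge (radial_loop G ccw i0 s)
                      (velocity (radial_loop G ccw i0) s)) 0 (INR q.*2)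
    (\big[Rplus/0]_(0 <= j < q)
       (arc_angle G ccw (row j) * radius (row j) ^ 2)).
Proof.
elim: q => [|q IH].
  by rewrite big_geq //; exact: is_RInt_point.
rewrite doubleS big_nat_recr //.
apply: is_RInt_Chasles IH _.
pose a := arc_angle G ccw (row q); pose r := radius (row q).
rewrite -[X in is_RInt _ _ _ X]Rplus_0_r.
apply: (is_RInt_Chasles _ _ (INR q.*2.+1)).
  rewrite (_ : _ * _ = (INR q.*2.+1 - INR q.*2) * (r ^ 2 * a));
    last by rewrite S_INR /a /r; ring.
  apply: (is_RInt_piece (w := fun s =>
    polar r (col_angle (colX G (row q)) + (s - INR q.*2) * a))).
  - by rewrite S_INR; lra.
  - by move=> s Hs; apply: radial_loop_arc; lra.
  - move=> s; apply: (is_derive_polar (r' := 0) (phi' := a)).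
      exact: is_derive_const.
    by auto_derive=> //; ring.
  by move=> s /=; rewrite wedge_polar.
rewrite (_ : 0 = (INR q.*2.+2 - INR q.*2.+1) * 0); last by ring.
pose r' := radius (row q.+1).
pose w s := polar ((1 - (s - INR q.*2.+1)) * r + (s - INR q.*2.+1) * r')
          (col_angle (colY G (row q))).
apply: (is_RInt_piece (w := w)).
- by rewrite [INR _.+2]S_INR; lra.
- by move=> s Hs; apply: radial_loop_segment; lra.
- move=> s; apply: (is_derive_polar (r' := r' - r) (phi' := 0)).
    by auto_derive=> //; ring.
  exact: is_derive_const.
by move=> s /=; rewrite wedge_polar; ring.
Qed.

Lemma angular_integral_radial_loop :
  angular_integral (radial_loop G ccw i0) 0 (2 * INR n)
  = \big[Rplus/0]_(i < n) (arc_angle G ccw i * radius i ^ 2).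
Proof.
rewrite -(big_next_row G i0) -(mult_INR 2).
have -> : Nat.mul 2 n = n.*2 by rewrite multE mul2n.
exact: is_RInt_unique (@is_RInt_radial_loop n).
Qed.

Lemma Cmod_radial_loop s :
  0 <= s -> Cmod (radial_loop G ccw i0 s) <= sqrt (1 / 3).
Proof.
move=> s0; rewrite /radial_loop.
have [Hf0 Hf1] := base_fp s.
set k := Z.to_nat _; set u := frac_part s in Hf0 Hf1 *.
have Hr (i : 'I_n) := radius_bounds i.
have [h1 h2] := Hr (iter k./2 (next_row G) i0).
case: (odd k); last by rewrite Cmod_polar.
have [h3 h4] := Hr (next_row G (iter k./2 (next_row G) i0)).
rewrite Cmod_polar; nra.
Qed.

End RadialLoop.

(** The estimate is only assumed over one period; any parameter is moved there
    by a multiple of [2 * PI]. *)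
Lemma smoothing_bound n (G : grid n) ccw eps gamma (th : R) :
  smoothing G ccw eps gamma -> Cmod (gamma th) <= sqrt (1 / 3) + eps.
Proof.
move=> [_ [per [i0 [h [_ [hinc [h0 [_ [close _]]]]]]]]].
pose T := 2 * PI.
have HT : 0 < T by have := PI_RGT_0; rewrite /T; lra.
have perZ (m : Z) t : gamma (t + T * IZR m) = gamma t.
  exact: periodic_IZR.
have [t [Ht ->]] : exists t, 0 <= t <= T /\ gamma th = gamma t.
  exists (th - T * IZR (Int_part (th / T))); split.
    have [] := base_Int_part (th / T) => H1 H2.
    have E : th = th / T * T by field; lra.
    split; nra.
  rewrite -[RHS](perZ (Int_part (th / T))); apply: f_equal.
  by rewrite /Rminus Rplus_assoc Rplus_opp_l Rplus_0_r.
have h_ge0 : 0 <= h t.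
  case: (Req_dec t 0) => [->//|t0].
  by have := hinc 0 t; lra.
rewrite (_ : gamma t = (radial_loop G ccw i0 (h t)
                        + (gamma t - radial_loop G ccw i0 (h t)))%C);
  last by apply: Cn1_eq; rewrite /=; ring.
apply: Rle_trans (Cmod_triangle _ _) _.
have := close t Ht; have := Cmod_radial_loop G ccw i0 h_ge0; lra.
Qed.

(** * Lagrangian cones *)

(* The operations of products of normed modules are unfolded to those of the
   reals, and the equation is restated at type [R], where [ring] applies. *)
Ltac ring_R :=
  rewrite /= /minus /opp /scal /plus /mult /=
    /prod_opp /prod_scal /prod_plus /scal /plus /opp /mult /=
    /prod_opp /prod_scal /prod_plus /scal /plus /opp /mult /=;
  match goal with |- @eq _ ?x ?y => change (@eq R x y) end; ring.

Definition inner (v w : Cn3) : R :=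
  fst v.1.1 * fst w.1.1 + snd v.1.1 * snd w.1.1
  + (fst v.1.2 * fst w.1.2 + snd v.1.2 * snd w.1.2)
  + (fst v.2 * fst w.2 + snd v.2 * snd w.2).

Definition cmul3 (e : C) (w : Cn3) : Cn3 :=
  ((e * w.1.1)%C, (e * w.1.2)%C, (e * w.2)%C).

Definition rotate (t : R) : Cn3 -> Cn3 := cmul3 (cos t, sin t).

(** The velocity of [r e^(it) u], turned back by [e^(-it)]. *)
Definition rotating_cone_velocity (r r' t' : R) (u u' : Cn3) : Cn3 :=
  plus (scal (r' : R_AbsRing) u)
    (scal (r : R_AbsRing) (plus u' (scal (t' : R_AbsRing) (cmul3 Ci u)))).

Lemma Cn3_eq (v w : Cn3) : v.1.1 = w.1.1 -> v.1.2 = w.1.2 -> v.2 = w.2 -> v = w.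
Proof. by case: v => [[a b] c]; case: w => [[d e] f] /= -> -> ->. Qed.

Lemma is_derive_Cn3_unique (F : R -> Cn3) s (v w : Cn3) :
  is_derive F s v -> is_derive F s w -> v = w.
Proof.
move=> Hv Hw; apply: Cn3_eq.
- rewrite -(velocity_unique (is_derive_fst (is_derive_fst Hv))).
  exact: velocity_unique (is_derive_fst (is_derive_fst Hw)).
- rewrite -(velocity_unique (is_derive_snd (is_derive_fst Hv))).
  exact: velocity_unique (is_derive_snd (is_derive_fst Hw)).
rewrite -(velocity_unique (is_derive_snd Hv)).
exact: velocity_unique (is_derive_snd Hw).
Qed.

Lemma is_derive_expi_mul (T : R -> R) (z : R -> C) s t' (z' : C) :
  is_derive T s t' -> @is_derive R_AbsRing Cn1 z s z' ->
  @is_derive R_AbsRing Cn1 (fun u => (cos (T u), sin (T u)) * z u)%C s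
    ((cos (T s), sin (T s)) * (z' + RtoC t' * (Ci * z s)))%C.
Proof.
move=> HT Hz.
have Hc : is_derive (fun u => cos (T u)) s (t' * - sin (T s)).
  by apply: (is_derive_comp cos T) => //; auto_derive=> //; ring_R.
have Hs : is_derive (fun u => sin (T u)) s (t' * cos (T s)).
  by apply: (is_derive_comp sin T) => //; auto_derive=> //; ring_R.
have Hx := is_derive_fst Hz; have Hy := is_derive_snd Hz.
have Mul f g f' g' : is_derive f s f' -> is_derive g s g' ->
    is_derive (fun u : R => f u * g u) s (f' * g s + f s * g').
  by move=> Hf Hg; exact: (is_derive_mult f g s f' g' Hf Hg Rmult_comm).
apply: (@is_derive_pair Eu1 Eu1).
  apply: eq_is_derive (is_derive_minus _ _ _ _ _ (Mul _ _ _ _ Hc Hx)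
    (Mul _ _ _ _ Hs Hy)) _.
  by ring_R.
apply: eq_is_derive (is_derive_plus _ _ _ _ _ (Mul _ _ _ _ Hc Hy)
  (Mul _ _ _ _ Hs Hx)) _.
by ring_R.
Qed.

Lemma is_derive_rotate (T : R -> R) (u : R -> Cn3) s t' (u' : Cn3) :
  is_derive T s t' -> is_derive u s u' ->
  is_derive (fun y => rotate (T y) (u y)) s
    (rotate (T s) (plus u' (scal (t' : R_AbsRing) (cmul3 Ci (u s))))).
Proof.
move=> HT Hu.
have E (z z' : C) : plus (z' : Cn1) (scal (t' : R_AbsRing) ((Ci * z)%C : Cn1))
    = (z' + RtoC t' * (Ci * z))%C.
  by apply: Cn1_eq; ring_R.
have H1 := is_derive_expi_mul HT (is_derive_fst (is_derive_fst Hu)).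
have H2 := is_derive_expi_mul HT (is_derive_snd (is_derive_fst Hu)).
have H3 := is_derive_expi_mul HT (is_derive_snd Hu).
rewrite -!E in H1 H2 H3.
exact: (is_derive_pair (is_derive_pair H1 H2) H3).
Qed.

Lemma is_derive_rotating_cone (r T : R -> R) (u : R -> Cn3) s r' t' (u' : Cn3) :
  is_derive r s r' -> is_derive T s t' -> is_derive u s u' ->
  is_derive (fun y => scal (r y : R_AbsRing) (rotate (T y) (u y))) s
    (rotate (T s) (rotating_cone_velocity (r s) r' t' (u s) u')).
Proof.
move=> Hr HT Hu.
have := filterdiff_scal_fct s _ _ _ _ Rmult_comm Hr (is_derive_rotate HT Hu).
move=> H; apply: filterdiff_ext_lin H _ => y.
apply: Cn3_eq; apply: Cn1_eq; ring_R.
Qed.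

Lemma symplectic_form_rotate t v w :
  symplectic_form (rotate t v) (rotate t w) = symplectic_form v w.
Proof.
have := sin2_cos2 t; rewrite /Rsqr => H.
transitivity ((sin t * sin t + cos t * cos t) * symplectic_form v w);
  last by rewrite H; ring_R.
by rewrite /symplectic_form /wedge /rotate /=; ring_R.
Qed.

Lemma rotate_eq0 t w : rotate t w = zero -> w = zero.
Proof.
have H := sin2_cos2 t; rewrite /Rsqr in H.
have Hz (z : C) : ((cos t, sin t) * z)%C = zero :> Cn1 -> z = zero :> Cn1.
  case: z => x y; rewrite /Cmult /zero /= => -[Hx Hy].
  have {}Hx : cos t * x - sin t * y = 0 by [].
  have {}Hy : cos t * y + sin t * x = 0 by [].
  apply: Cn1_eq; rewrite /= /zero /=.
    transitivity ((sin t * sin t + cos t * cos t) * x).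
      by rewrite H; ring_R.
    transitivity (cos t * (cos t * x - sin t * y)
                  + sin t * (cos t * y + sin t * x)).
      by ring_R.
    by rewrite Hx Hy; ring_R.
  transitivity ((sin t * sin t + cos t * cos t) * y).
    by rewrite H; ring_R.
  transitivity (cos t * (cos t * y + sin t * x)
                - sin t * (cos t * x - sin t * y)).
    by ring_R.
  by rewrite Hx Hy; ring_R.
case: w => [[a b] c] E; apply: Cn3_eq; apply: Hz.
- exact: (f_equal (fun w : Cn3 => w.1.1) E).
- exact: (f_equal (fun w : Cn3 => w.1.2) E).
exact: (f_equal (fun w : Cn3 => w.2) E).
Qed.

(** Expand bilinearly.  The pairing of [u] with [i u] is [inner u u] and that of
    [u1] with [i u] is [inner u u1], so the radial terms carry the factors
    [symplectic_form u uk + tk], and what remains is [symplectic_form u1 u2]. *)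
Lemma symplectic_form_cone r r1 r2 t1 t2 u u1 u2 :
  inner u u = 1 -> inner u u1 = 0 -> inner u u2 = 0 ->
  t1 = - symplectic_form u u1 -> t2 = - symplectic_form u u2 ->
  symplectic_form u1 u2 = 0 ->
  symplectic_form (rotating_cone_velocity r r1 t1 u u1)
                  (rotating_cone_velocity r r2 t2 u u2) = 0.
Proof.
move=> Hu H1 H2 E1 E2 H12.
transitivity (r1 * r * (symplectic_form u u2 + t2 * inner u u)
              - r2 * r * (symplectic_form u u1 + t1 * inner u u)
              + r * r * (symplectic_form u1 u2 + t2 * inner u u1
                         - t1 * inner u u2)).
  rewrite /symplectic_form /inner /wedge /rotating_cone_velocity.
  by ring_R.
by rewrite Hu H1 H2 H12 E1 E2; ring_R.
Qed.

(** Pairing with [u] isolates [r'].  Then the imaginary part of the last entry,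
    which is [t'] times the positive number [fst u.2], shows that there is no
    rotation, and only [u'] is left. *)
Lemma rotating_cone_velocity_eq0 r r' t' u u' :
  0 < r -> inner u u = 1 -> inner u u' = 0 ->
  snd u.2 = 0 -> snd u'.2 = 0 -> 0 < fst u.2 ->
  rotating_cone_velocity r r' t' u u' = zero -> r' = 0 /\ u' = zero.
Proof.
move=> r0 Hu Hu' im im' re E.
have r'0 : r' = 0.
  transitivity (inner u (rotating_cone_velocity r r' t' u u')).
    transitivity (r' * inner u u + r * inner u u').
      by rewrite Hu Hu'; ring_R.
    rewrite /inner /rotating_cone_velocity.
    by ring_R.
  by rewrite E /inner /zero /= /zero /=; ring_R.
have t'0 : t' = 0.
  have := f_equal (fun w : Cn3 => snd w.2) E.
  rewrite /= /scal /= /mult /plus /= /prod_plus /= im im' r'0 => Ei.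
  have : r * (t' * fst u.2) = 0.
    by rewrite -[RHS]Ei /zero /=; ring_R.
  move/Rmult_integral => [|/Rmult_integral []]; lra.
split=> //.
have {}E : scal (r : R_AbsRing) u' = zero.
  rewrite -E r'0 t'0 /rotating_cone_velocity !scal_zero_l plus_zero_l.
  by rewrite plus_zero_r.
have -> : u' = scal (/ r : R_AbsRing) (scal (r : R_AbsRing) u').
  rewrite scal_assoc (_ : mult _ _ = one) ?scal_one //.
  by apply: Rinv_l; lra.
by rewrite E scal_zero_r.
Qed.

(** At [(1, p)] the cone has tangent vectors [F p], in the radial direction, and
    those of [F].  The contact form at [F p] is half the symplectic pairing of
    the first with the second. *)
Lemma legendrian_of_lagrangian_cone (F : Eu2 -> Cn3) :
  torus_map F -> smooth (@all_of Eu2) F -> (forall p, in_sphere5 (F p)) ->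
  immersed_lagrangian cone_domain (cone F) -> immersed_legendrian_torus F.
Proof.
move=> per smF sph [[_ inj] lag].
have slice p v w : differential_at F p v w ->
    differential_at (cone F) ((1, p) : Eu3) ((0, v) : Eu3) w.
  apply: is_derive_ext => s.
  transitivity (scal (1 + s * 0 : R_AbsRing) (F (plus p (scal s v)))) => //.
  by rewrite Rmult_0_r Rplus_0_r scal_one.
have ray p : differential_at (cone F) ((1, p) : Eu3) ((1, zero) : Eu3) (F p).
  have H : is_derive (fun s : R => 1 + s * 1) 0 1 by auto_derive=> //; ring_R.
  have := is_derive_scal_l _ _ _ (F p) H.
  rewrite scal_one; apply: is_derive_ext => s.
  transitivity (scal (1 + s * 1 : R_AbsRing) (F (plus p (scal s zero)))) => //.
  by rewrite scal_zero_r plus_zero_r.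
have dom p : cone_domain ((1, p) : Eu3) by rewrite /cone_domain /=; lra.
split; [split=> //; split=> // | split=> //].
  move=> p v _ /slice /(inj _ _ (dom p)) E.
  exact: (f_equal snd E).
move=> p v w /slice Hw.
have := lag _ _ _ _ _ (dom p) (ray p) Hw.
by rewrite /contact_form /symplectic_form => ->; ring_R.
Qed.

(** * The Legendrian lift *)

Definition height_sqr (p : Cn2) : R :=
  1 - fst p.1 ^ 2 - snd p.1 ^ 2 - fst p.2 ^ 2 - snd p.2 ^ 2.

Lemma Cmod_sqr (z : C) : Cmod z ^ 2 = fst z ^ 2 + snd z ^ 2.
Proof. by rewrite /Cmod pow2_sqrt //; nra. Qed.

Lemma height_sqr_gt0 p : in_ball2 p -> 0 < height_sqr p.
Proof. by rewrite /in_ball2 /height_sqr !Cmod_sqr; lra. Qed.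

Lemma lift_point_sphere t p : in_ball2 p -> in_sphere5 (lift_point t p).
Proof.
move=> /height_sqr_gt0 Hp; rewrite /in_sphere5 /lift_point; cbn [fst snd].
rewrite !Cmod_mult !Rpow_mult_distr !Cmod_sqr /=.
have := sin2_cos2 t; rewrite /Rsqr => H.
rewrite -!/(height_sqr p).
have Hs := sqrt_sqrt (height_sqr p) (Rlt_le _ _ Hp).
transitivity ((sin t * sin t + cos t * cos t)
   * (fst p.1 ^ 2 + snd p.1 ^ 2 + (fst p.2 ^ 2 + snd p.2 ^ 2)
      + sqrt (height_sqr p) * sqrt (height_sqr p))); first by rewrite /=; ring.
by rewrite H Hs /height_sqr; ring.
Qed.

Lemma lift_point_period t p m :
  lift_point (t + 2 * PI * IZR m) p = lift_point t p.
Proof.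
apply: (periodic_IZR (F := fun t => lift_point t p)) => s.
rewrite (_ : s + 2 * PI = s + 2 * INR 1 * PI); last by rewrite /=; ring.
by rewrite /lift_point cos_period sin_period.
Qed.

Section Lift.
Variables (gamma1 gamma2 : Eu1 -> Cn1) (base : Eu2).
Hypotheses (imm1 : immersion (@all_of Eu1) gamma1)
           (imm2 : immersion (@all_of Eu1) gamma2).
Hypotheses (per1 : forall s : R, gamma1 (s + 2 * PI) = gamma1 s)
           (per2 : forall s : R, gamma2 (s + 2 * PI) = gamma2 s).
Let f := product_torus gamma1 gamma2.

Lemma immersed_product_torus : immersed_torus f.
Proof.
split.
  move=> p q [m [k [E1 E2]]]; rewrite /f /product_torus E1 E2.
  by rewrite !periodic_IZR.
split.
  move=> k; apply: (@class_C_pair Eu2 Cn1 Cn1).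
    exact: (class_C_prelinear is_linear_fst (imm1.1 k)).
  exact: (class_C_prelinear is_linear_snd (imm2.1 k)).
move=> p v _ H.
have E1 := imm1.2 (fst p) (fst v) I (is_derive_fst H).
have E2 := imm2.2 (snd p) (snd v) I (is_derive_snd H).
by rewrite (surjective_pairing v) E1 E2.
Qed.

Definition torus_velocity (p v : Eu2) : Cn2 :=
  (scal (fst v : R_AbsRing) (velocity gamma1 (fst p) : Cn1),
   scal (snd v : R_AbsRing) (velocity gamma2 (snd p) : Cn1)).

Lemma differential_product_torus p v :
  differential_at f p v (torus_velocity p v).
Proof.
apply: is_derive_pair.
  exact: (differential_of_is_derive (fst v)
    (is_derive_velocity imm1.1 (fst p))).
exact: (differential_of_is_derive (snd v)
  (is_derive_velocity imm2.1 (snd p))).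
Qed.

(** The phase [t].  On the universal cover it is a function; the integral of tau
    along a path of the torus determines it up to multiples of [2 * PI]. *)
Definition potential (p : Eu2) : R :=
  - (angular_integral gamma1 (fst base) (fst p)
     + angular_integral gamma2 (snd base) (snd p)).

Definition tau_at (p w : Cn2) : R := - (wedge p.1 w.1 + wedge p.2 w.2).

Lemma differential_potential p v :
  differential_at potential p v (tau_at (f p) (torus_velocity p v)).
Proof.
have H1 := is_derive_angular_integral_line imm1.1 (fst base) (fst p) (fst v).
have H2 := is_derive_angular_integral_line imm2.1 (snd base) (snd p) (snd v).
exact: is_derive_opp _ _ _ (is_derive_plus _ _ _ _ _ H1 H2).
Qed.

Lemma smooth_potential : smooth (@all_of Eu2) potential.
Proof.
move=> k.
have S1 := smooth_angular_integral imm1.1 (fst base) k.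
have S2 := smooth_angular_integral imm2.1 (snd base) k.
apply: (class_C_comp (E := @all_of Eu1) (g := Ropp)) => //.
  apply: class_C_opp; apply: class_C_linear; exact: is_linear_id.
apply: (@class_C_plus Eu2 Eu1).
  exact: (class_C_prelinear is_linear_fst S1).
exact: (class_C_prelinear is_linear_snd S2).
Qed.

Hypothesis ball : forall p, in_ball2 (f p).

(** The lift before rotation by [e^(it)]. *)
Definition hemisphere (p : Eu2) : Cn3 := (f p, RtoC (sqrt (height_sqr (f p)))).

Definition hemisphere_velocity (p v : Eu2) : Cn3 :=
  let z := f p in let w := torus_velocity p v in
  (w, RtoC (- (fst z.1 * fst w.1 + snd z.1 * snd w.1
               + (fst z.2 * fst w.2 + snd z.2 * snd w.2))
           / sqrt (height_sqr z))).

Lemma differential_hemisphere p v :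
  differential_at hemisphere p v (hemisphere_velocity p v).
Proof.
have Hf := differential_product_torus p v.
apply: (is_derive_pair Hf).
apply: (@is_derive_pair Eu1 Eu1); last exact: is_derive_const.
have Hx1 := is_derive_fst (is_derive_fst Hf).
have Hy1 := is_derive_snd (is_derive_fst Hf).
have Hx2 := is_derive_fst (is_derive_snd Hf).
have Hy2 := is_derive_snd (is_derive_snd Hf).
have f0 : f (plus p (scal 0 v)) = f p by rewrite scal_zero_l plus_zero_r.
have Hpos := height_sqr_gt0 (ball p).
have Sq g (g' : R) : is_derive g 0 g' ->
    is_derive (fun s : R => g s ^ 2) 0 (2 * g 0 * g').
  move=> Hg; apply: eq_is_derive (is_derive_pow g 2 0 g' Hg) _.
  by ring_R.
have H1 : is_derive (fun _ : R => 1) 0 0 by exact: is_derive_const.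
have Hr := is_derive_minus _ _ _ _ _ (is_derive_minus _ _ _ _ _
  (is_derive_minus _ _ _ _ _ (is_derive_minus _ _ _ _ _ H1 (Sq _ _ Hx1))
     (Sq _ _ Hy1)) (Sq _ _ Hx2)) (Sq _ _ Hy2).
apply: eq_is_derive (is_derive_sqrt _ _ _ Hr _) _.
  by move: Hpos; rewrite -f0.
rewrite f0 -[X in _ / (2 * sqrt X)]/(height_sqr (f p)).
have Hs := sqrt_lt_R0 _ Hpos.
move: (torus_velocity p v) => w; rewrite /minus /plus /opp.
by cbn -[sqrt height_sqr f]; field; lra.
Qed.

Definition lift (p : Eu2) : Cn3 := lift_point (potential p) (f p).

Lemma smooth_lift : smooth (@all_of Eu2) lift.
Proof.
move=> k.
have [_ [/(_ k) Cf _]] := immersed_product_torus.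
have Cz1 := class_C_postlinear is_linear_fst Cf.
have Cz2 := class_C_postlinear is_linear_snd Cf.
have Cx1 := class_C_postlinear is_linear_fst Cz1.
have Cy1 := class_C_postlinear is_linear_snd Cz1.
have Cx2 := class_C_postlinear is_linear_fst Cz2.
have Cy2 := class_C_postlinear is_linear_snd Cz2.
have Ct := smooth_potential k.
have Ce : class_C (@all_of Eu2) k
    (fun p => (cos (potential p), sin (potential p)) : Cn1).
  apply: (@class_C_pair Eu2 Eu1 Eu1).
    by apply: (class_C_comp (E := @all_of Eu1)) Ct => //;
       exact: (class_C_cos_sin _ _).1.
  by apply: (class_C_comp (E := @all_of Eu1)) Ct => //;
     exact: (class_C_cos_sin _ _).2.
have Ch : class_C (@all_of Eu2) k
    (fun p => RtoC (sqrt (height_sqr (f p))) : Cn1).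
  apply: (@class_C_pair Eu2 Eu1 Eu1); last exact: class_C_const.
  apply: (class_C_comp (E := positive) (F := fun p => height_sqr (f p))).
  - by move=> p _; exact: height_sqr_gt0.
  - exact: class_C_sqrt.
  have C1 := class_C_const (@all_of Eu2) k (1 : Eu1).
  exact: (class_C_minus (class_C_minus (class_C_minus (class_C_minus C1
    (class_C_sqr Cx1)) (class_C_sqr Cy1)) (class_C_sqr Cx2)) (class_C_sqr Cy2)).
exact: (class_C_pair (class_C_pair (class_C_Cmult Ce Cz1)
  (class_C_Cmult Ce Cz2)) (class_C_Cmult Ce Ch)).
Qed.

Lemma differential_cone_lift (q v : Eu3) :
  differential_at (cone lift) q v
    (rotate (potential (snd q))
       (rotating_cone_velocity (fst q) (fst v)
          (tau_at (f (snd q)) (torus_velocity (snd q) (snd v)))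
          (hemisphere (snd q)) (hemisphere_velocity (snd q) (snd v)))).
Proof.
have Hr : is_derive (fun s : R => fst q + s * fst v) 0 (fst v).
  by auto_derive=> //; ring_R.
have := is_derive_rotating_cone Hr (differential_potential (snd q) (snd v))
  (differential_hemisphere (snd q) (snd v)).
by rewrite !scal_zero_l !plus_zero_r Rmult_0_l Rplus_0_r.
Qed.

Lemma inner_hemisphere p : inner (hemisphere p) (hemisphere p) = 1.
Proof.
have Hs := sqrt_sqrt _ (Rlt_le _ _ (height_sqr_gt0 (ball p))).
rewrite /inner /= Hs /height_sqr; ring_R.
Qed.

Lemma inner_hemisphere_velocity p v :
  inner (hemisphere p) (hemisphere_velocity p v) = 0.
Proof.
have Hs := sqrt_lt_R0 _ (height_sqr_gt0 (ball p)).
by rewrite /inner /=; field; lra.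
Qed.

Lemma lagrangian_cone_lift : immersed_lagrangian cone_domain (cone lift).
Proof.
split; [split|].
- move=> k.
  have Cr : class_C cone_domain k (fun q : Eu3 => fst q : Eu1).
    apply: class_C_linear; exact: is_linear_fst.
  have Cl : class_C cone_domain k (fun q : Eu3 => lift (snd q)).
    apply: (class_C_mono (D := fun q => @all_of Eu2 (snd q))) => //.
    exact: (class_C_prelinear is_linear_snd (smooth_lift k)).
  exact: class_C_scal Cr Cl.
- move=> q v q0 H.
  have := is_derive_Cn3_unique H (differential_cone_lift q v).
  move/esym/rotate_eq0/rotating_cone_velocity_eq0.
  case=> //.
  + exact: inner_hemisphere.
  + exact: inner_hemisphere_velocity.
  + exact: sqrt_lt_R0 (height_sqr_gt0 (ball _)).
  move=> v1 H2.
  have Hz : torus_velocity (snd q) (snd v) = zero := f_equal fst H2.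
  have Hf := differential_product_torus (snd q) (snd v).
  rewrite Hz in Hf.
  by rewrite (surjective_pairing v) v1 (immersed_product_torus.2.2 _ _ I Hf).
move=> q v1 v2 w1 w2 q0 H1 H2.
rewrite (is_derive_Cn3_unique H1 (differential_cone_lift q v1)).
rewrite (is_derive_Cn3_unique H2 (differential_cone_lift q v2)).
rewrite symplectic_form_rotate; apply: symplectic_form_cone.
- exact: inner_hemisphere.
- exact: inner_hemisphere_velocity.
- exact: inner_hemisphere_velocity.
- rewrite /tau_at /symplectic_form /wedge /=; ring_R.
- rewrite /tau_at /symplectic_form /wedge /=; ring_R.
rewrite /symplectic_form /wedge /=; ring_R.
Qed.

Variables k1 k2 : Z.
Hypotheses (area1 : angular_integral gamma1 0 (2 * PI) = 2 * PI * IZR k1)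
           (area2 : angular_integral gamma2 0 (2 * PI) = 2 * PI * IZR k2).

(** Subtracting [u * IZR k] from the primitive makes it periodic. *)
Lemma angular_integral_turns gamma k a s m :
  immersion (@all_of Eu1) gamma ->
  (forall s : R, gamma (s + 2 * PI) = gamma s) ->
  angular_integral gamma 0 (2 * PI) = 2 * PI * IZR k ->
  angular_integral gamma a (s + 2 * PI * IZR m)
  = angular_integral gamma a s + 2 * PI * IZR (k * m).
Proof.
move=> imm per area.
pose F u := angular_integral gamma a u - u * IZR k.
have PF u : F (u + 2 * PI) = F u.
  by rewrite /F (angular_integral_periodic imm.1 a per) area; ring.
have := periodic_IZR PF m s; rewrite /F mult_IZR; lra.
Qed.

Lemma lift_same_point p q : same_torus_point p q -> lift p = lift q.
Proof.
move=> Hpq; rewrite /lift (immersed_product_torus.1 _ _ Hpq).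
have [m [k [E1 E2]]] := Hpq.
rewrite -[LHS](lift_point_period _ _ (- (k1 * m + k2 * k))); congr lift_point.
rewrite /potential E1 E2.
rewrite (angular_integral_turns _ _ _ imm1 per1 area1).
rewrite (angular_integral_turns _ _ _ imm2 per2 area2).
rewrite opp_IZR plus_IZR; ring_R.
Qed.

Lemma lift_path p c : torus_path c base p ->
  lift p = lift_point (tau_integral (fun s => f (c s))) (f p).
Proof.
move=> [pc [Hbase Hp]].
have I1 := angular_integral_path (x0 := fst base) imm1.1 is_linear_fst pc.
have I2 := angular_integral_path (x0 := snd base) imm2.1 is_linear_snd pc.
have -> : tau_integral (fun s => f (c s)) = potential (c 1) - potential (c 0).
  rewrite /tau_integral /angular_integral.
  rewrite (is_RInt_unique _ _ _ _ I1) (is_RInt_unique _ _ _ _ I2).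
  rewrite /potential; ring_R.
rewrite (lift_same_point Hp) /lift (immersed_product_torus.1 _ _ Hp).
have [m [k [E1 E2]]] := Hbase.
rewrite -[RHS](lift_point_period _ _ (- (k1 * m + k2 * k))); congr lift_point.
have A0 gamma a : angular_integral gamma a a = 0 by exact: RInt_point.
have -> : potential (c 0) = - (2 * PI * IZR (k1 * m + k2 * k)).
  rewrite /potential E1 E2.
  rewrite (angular_integral_turns _ _ _ imm1 per1 area1).
  rewrite (angular_integral_turns _ _ _ imm2 per2 area2).
  rewrite !A0 plus_IZR; ring_R.
rewrite opp_IZR; ring_R.
Qed.

End Lift.

Theorem theorem4p23 (n : nat) (G1 G2 : grid n) (ccw1 ccw2 : 'I_n -> bool)
  (k1 k2 : Z) :
  \big[Rplus/0]_(i < n) (arc_angle G1 ccw1 i * radius i ^ 2)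
    = 2 * PI * IZR k1 ->
  \big[Rplus/0]_(i < n) (arc_angle G2 ccw2 i * radius i ^ 2)
    = 2 * PI * IZR k2 ->
  exists eps : R, 0 < eps /\
  forall gamma1 gamma2 : Eu1 -> Cn1,
    smoothing G1 ccw1 eps gamma1 -> smoothing G2 ccw2 eps gamma2 ->
    let f := product_torus gamma1 gamma2 in
    (forall th, in_ball2 (f th)) /\
    immersed_torus f /\
    forall base : Eu2, exists ft : Eu2 -> Cn3,
      (forall (th : Eu2) (c : Eu1 -> Eu2), torus_path c base th ->
         ft th = lift_point (tau_integral (fun s => f (c s))) (f th)) /\
      immersed_legendrian_torus ft /\
      immersed_lagrangian cone_domain (cone ft).
Proof.
(* (1 / sqrt 3 + 1/10)^2 < 1/2, so that two factors fit into the ball. *)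
move=> area1 area2; exists (/ 10); split; first lra.
move=> gamma1 gamma2 S1 S2 f.
have half n' (G : grid n') ccw gamma s :
    smoothing G ccw (/ 10) gamma -> Cmod (gamma s) ^ 2 < / 2.
  move=> /(fun S => smoothing_bound s S) Hs.
  have H13 : sqrt (1 / 3) <= 58 / 100.
    rewrite -[X in _ <= X]sqrt_pow2; last lra.
    by apply: sqrt_le_1_alt; lra.
  have := Cmod_ge_0 (gamma s); nra.
have ball p : in_ball2 (f p).
  by have := half _ _ _ _ (fst p) S1; have := half _ _ _ _ (snd p) S2;
     rewrite /in_ball2 /=; lra.
have loop n' (G : grid n') ccw gamma k : smoothing G ccw (/ 10) gamma ->
    \big[Rplus/0]_(i < n') (arc_angle G ccw i * radius i ^ 2)
      = 2 * PI * IZR k ->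
    angular_integral gamma 0 (2 * PI) = 2 * PI * IZR k.
  move=> [_ [_ [i0 [h [_ [_ [_ [_ [_ [_ ->]]]]]]]]]] <-.
  exact: angular_integral_radial_loop.
have {}area1 := loop _ _ _ _ _ S1 area1.
have {}area2 := loop _ _ _ _ _ S2 area2.
have [imm1 [per1 _]] := S1; have [imm2 [per2 _]] := S2.
split=> //; split; first exact: immersed_product_torus.
move=> base; exists (lift gamma1 gamma2 base).
have lag := lagrangian_cone_lift base imm1 imm2 per1 per2 ball.
split; [|split] => //.
  by move=> p c; exact: (lift_path imm1 imm2 per1 per2 area1 area2).
apply: legendrian_of_lagrangian_cone => //.
- by move=> p q; exact: (lift_same_point base imm1 imm2 per1 per2 area1 area2).
- exact: smooth_lift.
by move=> p; exact: lift_point_sphere.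
Qed.
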